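(* For every square matrix $A$ with nonnegative real entries, $$\operatorname{sm}(A)=\lim_{m\to\infty}\operatorname{pm}(A\otimes U_m),$$ where $U_m$ is the $m\times m$ matrix all of whose entries are $1$ and $\otimes$ denotes the Kronecker product.
   Context: The permanental mean of an $n\times n$ matrix $A=(a_{ij})$ with nonnegative entries is $\operatorname{pm}(A)=\left(\frac{\operatorname{per}A}{n!}\right)^{1/n}$, where $\operatorname{per}A=\sum_{\sigma\in S_n}\prod_{i=1}^n a_{i,\sigma(i)}$ is the permanent. The scaling mean of such a matrix is $$\operatorname{sm}(A)=\frac{1}{n^2}\inf_{x,y\in(0,\infty)^n}\frac{x^\top A y}{\operatorname{gm}(x)\operatorname{gm}(y)},$$ where vectors are column vectors and $\operatorname{gm}(x)=(x_1\cdots x_n)^{1/n}$. The Kronecker product $A\otimes B$ is the block matrix whose $(i,j)$ block is $a_{ij}B$. *)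

(* Defs.v *)
From mathcomp Require Import all_boot all_order all_algebra all_fingroup.
From mathcomp Require Import all_classical all_reals all_analysis.
From mathcomp Require Export mxtens.

Set Implicit Arguments.
Unset Strict Implicit.
Unset Printing Implicit Defensive.

Import Order.TTheory GRing.Theory Num.Theory.
Import numFieldNormedType.Exports.

Local Open Scope classical_set_scope.
Local Open Scope ring_scope.

Definition permanent (R : realType) (n : nat) (A : 'M[R]_n) : R :=
  \sum_(s : 'S_n) \prod_(i < n) A i (s i).

Definition perm_mean (R : realType) (n : nat) (A : 'M[R]_n) : R :=
  (permanent A / n`!%:R) `^ n%:R^-1.

Definition geom_mean (R : realType) (n : nat) (x : 'cV[R]_n) : R :=
  (\prod_(i < n) x i ord0) `^ n%:R^-1.

(* [x^T *m A *m y] is a 1 x 1 matrix; its unique entry is the bilinear form.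
   The set below is nonempty, and bounded below by 0 when A is nonnegative, so
   [inf] (which is 0 on sets without infimum) is then the true infimum. *)
Definition scaling_mean (R : realType) (n : nat) (A : 'M[R]_n) : R :=
  (n%:R ^+ 2)^-1 *
  inf [set t : R | exists x y : 'cV[R]_n,
        [/\ forall i, 0 < x i ord0, forall i, 0 < y i ord0 &
            t = (x^T *m A *m y) ord0 ord0 / (geom_mean x * geom_mean y)]].

Definition ones_mx (R : realType) (m : nat) : 'M[R]_m := const_mx 1.

(* Main.v *)
(** With K = n m, grouping the permutations of the K indices by the blocks they
    connect gives
      per (A (x) U_m) = m!^(2n) * sum_N prod_ij a_ij^N_ij / N_ij!,
    the sum being over the n x n tables N of naturals with all margins m.

    Upper bound: per (A (x) U_m) is m!^n times a coefficient of
    prod_i (sum_j a_ij y_j)^m, hence is at most m!^n prod_i (A y)_i^m / prod_j y_j^m;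
    AM-GM on the x_i (A y)_i then brings in x^T A y.

    Lower bound, for positive A: take the table N of largest weight
    prod_ij a_ij^N_ij / N_ij!. Optimality under moving units along cycles of rows
    gives, through shortest-path potentials, positive vectors x and y with
    N_ij <= x_i a_ij y_j <= N_ij + 1. So x^T A y <= n (m + n), which bounds sm A,
    and the single term N already has weight at least
    prod_ij N_ij^N_ij / N_ij! / prod_i (x_i y_i)^m.

    By k^k e^-k <= k! <= e (k + 1) k^k e^-k, both bounds on per (A (x) U_m) / K!
    are (sm A)^K up to a factor (m / (m + n))^K and a power of e (K + 1) of
    bounded exponent, which disappear in the K-th root. *)
Require Import Defs.
From mathcomp Require Import all_boot all_order all_algebra all_fingroup.
From mathcomp Require Import all_classical all_reals all_analysis.
From mathcomp Require Import ring lra.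
Import Order.TTheory GRing.Theory Num.Theory.
Import numFieldNormedType.Exports.

Set Implicit Arguments.
Unset Strict Implicit.
Unset Printing Implicit Defensive.

(** * Tuples with prescribed counts *)

Lemma sum_tuple_cons (T : finType) K (F : K.+1.-tuple T -> nat) :
  \sum_s F s = \sum_t \sum_(s : K.-tuple T) F [tuple of t :: s].
Proof.
rewrite pair_big /= (reindex (fun p : T * K.-tuple T => [tuple of p.1 :: p.2])) //.
exists (fun s => (thead s, [tuple of behead s])) => [[t s] _|s _] /=.
  by congr (_, _); apply: val_inj.
by rewrite -tuple_eta.
Qed.

(** The multinomial coefficient, kept as a product so that no division occurs. In the induction, a
    first entry [t] leaves the counts [N] lowered by one at [t] and contributes a factor [N t];
    these factors add up to [K.+1]. *)
Lemma card_tuple_counts (T : finType) K (N : T -> nat) : \sum_t N t = K ->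
  #|[pred s : K.-tuple T | [forall t, count_mem t s == N t]]| * \prod_t (N t)`! = K`!.
Proof.
elim: K N => [|K IHK] N sumN.
  have N0 t : N t = 0 by apply/eqP; rewrite -leqn0 -sumN (bigD1 t) //= leq_addr.
  rewrite big1 ?muln1 => [|t _]; last by rewrite N0.
  rewrite (eq_card (B := predT)) ?card_tuple // => s.
  by rewrite !inE tuple0 /=; apply/forallP => t; rewrite N0.
rewrite -sum1_card big_mkcond /= sum_tuple_cons big_distrl /= factS -[in RHS]sumN.
rewrite [RHS]big_distrl /=; apply: eq_bigr => t _.
case Nt: (N t) => [|k].
  rewrite big1 ?mul0n // => s _; case: ifP => //; rewrite inE => /forallP/(_ t).
  by rewrite /= eqxx Nt.
pose N' u := N u - (u == t).
have N't : N' t = k by rewrite /N' eqxx Nt subn1.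
have N'D u : u != t -> N' u = N u by move=> /negPf ut; rewrite /N' ut subn0.
have sumN' : \sum_u N' u = K.
  apply/eqP; rewrite -eqSS -[X in _ == X]sumN [X in _ == X](bigD1 t) //= Nt (bigD1 t) //= N't.
  by rewrite (eq_bigr N) // => u /N'D.
rewrite -(IHK N') // -sum1_card [in RHS]big_mkcond /=.
rewrite (bigD1 t) //= Nt factS [in RHS](bigD1 t) //= N't.
rewrite [in RHS](eq_bigr (fun u => (N u)`!)) => [|u /N'D -> //].
rewrite [in RHS]mulnCA -!mulnA; congr (_ * _); apply: eq_bigr => s _.
congr (if _ then _ else _); rewrite !inE; apply: eq_forallb => u /=.
rewrite [t == u]eq_sym; case: (eqVneq u t) => [->|/N'D ->] //=.
by rewrite Nt N't add1n eqSS.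
Qed.

(** Left translation by a permutation taking [g] to [s] identifies the two fibres, so all fibres
    have equal size. That size is [K!] divided by the number of rearrangements of [g], a multinomial
    coefficient. *)
Lemma card_perm_tuple (T : finType) K (g s : K.-tuple T) : perm_eq s g ->
  #|[pred p : 'S_K | [tuple tnth g (p i) | i < K] == s]| = \prod_t (count_mem t g)`!.
Proof.
pose fib (s : K.-tuple T) := [pred p : 'S_K | [tuple tnth g (p i) | i < K] == s].
have fibE (s' : K.-tuple T) : perm_eq s' g -> #|fib s'| = #|fib g|.
  case/tuple_permP => q /val_inj ->.
  rewrite -[RHS](card_imset _ (mulgI q)).
  apply: eq_card => p; apply/idP/imsetP => [/eqP pq|[r /eqP rg ->]].
    exists (q^-1 * p)%g; last by rewrite mulKVg.
    apply/eqP/eq_from_tnth => i; move/(congr1 (fun u => tnth u (q^-1%g i))): pq.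
    by rewrite !tnth_mktuple permM permKV.
  apply/eqP/eq_from_tnth => i; rewrite !tnth_mktuple permM.
  by move/(congr1 (fun u => tnth u (q i))): rg; rewrite !tnth_mktuple.
move=> /fibE ->.
have sumK : \sum_t count_mem t g = K.
  rewrite -[RHS](size_tuple g) -sum1_size.
  under eq_bigr do rewrite -sum1_count.
  rewrite (exchange_big_dep predT) //=; apply: eq_bigr => i _.
  by rewrite (big_pred1 i).
have orbE : #|[pred s : K.-tuple T | perm_eq s g]| * \prod_t (count_mem t g)`! = K`!.
  rewrite -(card_tuple_counts sumK); congr (_ * _); apply: eq_card => s'.
  rewrite !inE; apply/idP/forallP => [/seq.permP s'g t|s'g]; first by rewrite s'g.
  by apply/allP => t _; rewrite /= (eqP (s'g t)).
have : #|[pred s : K.-tuple T | perm_eq s g]| * #|fib g| = K`!.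
  rewrite -[in RHS](card_Sn K) -[RHS]sum1_card.
  rewrite (partition_big (fun p : 'S_K => [tuple tnth g (p i) | i < K])
             (fun s' => perm_eq s' g)) /=; last first.
    by move=> p _; apply/tuple_permP; exists p.
  rewrite -sum_nat_const; apply: eq_bigr => s' /fibE <-.
  by rewrite -sum1_card; apply: eq_bigl.
rewrite -orbE => /eqP; rewrite eqn_pmul2l => [/eqP //|].
by apply/card_gt0P; exists g; rewrite inE.
Qed.

Lemma sum_perm_tuple (R : pzSemiRingType) (T : finType) K (g : K.-tuple T)
    (F : K.-tuple T -> R) :
  (\sum_(p : 'S_K) F [tuple tnth g (p i) | i < K] =
   (\prod_t (count_mem t g)`!)%:R * \sum_(s : K.-tuple T | perm_eq s g) F s)%R.
Proof.
rewrite (partition_big (fun p : 'S_K => [tuple tnth g (p i) | i < K])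
             (fun s : K.-tuple T => perm_eq s g)) /=; last first.
  by move=> p _; apply/tuple_permP; exists p.
rewrite GRing.mulr_sumr; apply: eq_bigr => s sg.
rewrite (eq_bigr (fun=> F s)) => [|p /eqP -> //].
by rewrite GRing.sumr_const card_perm_tuple // GRing.mulr_natl.
Qed.

Local Open Scope classical_set_scope.
Local Open Scope ring_scope.

(** * The permanent of A (x) U_m *)

Section Kronecker.
Variables (R : realType) (n m : nat).

(** Colours each index by its block: an entry of [A *t ones_mx R m] depends only on the colours of
    its row and column. *)
Definition block_tuple : (n * m).-tuple 'I_n :=
  [tuple (mxtens_unindex t).1 | t < n * m].

Lemma count_block_tuple i : count_mem i block_tuple = m.
Proof.
rewrite -sum1_count big_tuple (reindex (@mxtens_index n m)) /=; last first.
  by exists (@mxtens_unindex n m) => x _; rewrite ?mxtens_indexK ?mxtens_unindexK.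
rewrite (eq_bigl (fun p : 'I_n * 'I_m => (p.1 == i) && true)); last first.
  by move=> p; rewrite tnth_mktuple mxtens_indexK andbT.
by rewrite -(pair_big (pred1 i) predT (fun _ _ => 1%N)) /= big_pred1_eq sum1_card card_ord.
Qed.

Lemma permanent_tens_ones (A : 'M[R]_n) :
  permanent (A *t ones_mx R m) =
  \sum_(s : 'S_(n * m)) \prod_t
     A (tnth block_tuple t) (tnth [tuple tnth block_tuple (s t) | t < n * m] t).
Proof.
apply: eq_bigr => s _; apply: eq_bigr => t _.
by rewrite !tnth_mktuple !mxE mulr1.
Qed.

Lemma permanent_tens_onesE (A : 'M[R]_n) :
  permanent (A *t ones_mx R m) = m`!%:R ^+ n *
    \sum_(c : (n * m).-tuple 'I_n | perm_eq c block_tuple)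
      \prod_t A (tnth block_tuple t) (tnth c t).
Proof.
rewrite permanent_tens_ones.
rewrite (sum_perm_tuple block_tuple
  (fun c => \prod_t A (tnth block_tuple t) (tnth c t))).
by under eq_bigr do rewrite count_block_tuple; rewrite prod_nat_const card_ord natrX.
Qed.

(* Averaging over the row permutation as well makes rows and columns play
   symmetric roles. *)
Lemma permanent_tens_ones_sym (A : 'M[R]_n) :
  (n * m)`!%:R * permanent (A *t ones_mx R m) = m`!%:R ^+ n * (m`!%:R ^+ n *
    \sum_(r : (n * m).-tuple 'I_n | perm_eq r block_tuple)
    \sum_(c : (n * m).-tuple 'I_n | perm_eq c block_tuple)
      \prod_t A (tnth r t) (tnth c t)).
Proof.
have cntE : (\prod_i (count_mem i block_tuple)`!)%:R = m`!%:R ^+ n :> R.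
  by under eq_bigr do rewrite count_block_tuple; rewrite prod_nat_const card_ord natrX.
pose G (r : (n * m).-tuple 'I_n) : R := m`!%:R ^+ n *
  \sum_(c : (n * m).-tuple 'I_n | perm_eq c block_tuple)
    \prod_t A (tnth r t) (tnth c t).
have := sum_perm_tuple block_tuple G; rewrite cntE => GE.
rewrite [X in _ = _ * X]mulr_sumr -GE.
rewrite -[X in X%:R * _](card_Sn (n * m)) mulr_natl -sumr_const.
apply: eq_bigr => p _; rewrite permanent_tens_ones.
have := sum_perm_tuple block_tuple (fun c : (n * m).-tuple 'I_n =>
   \prod_t A (tnth [tuple tnth block_tuple (p i) | i < n * m] t) (tnth c t)).
rewrite cntE /G => <-.
rewrite (reindex_inj (mulgI p^-1%g)); apply: eq_bigr => s _.
rewrite [RHS](reindex_inj (@perm_inj _ p^-1%g)); apply: eq_bigr => t _.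
by rewrite !tnth_mktuple permKV permM.
Qed.

End Kronecker.

Lemma prod_tuple_count (R : comPzSemiRingType) (T : finType) K (F : T -> R)
    (s : K.-tuple T) :
  \prod_t F (tnth s t) = \prod_x F x ^+ count_mem x s.
Proof.
rewrite -(big_tuple _ _ s predT F) /=; elim: (tval s) => [|y {}s IHs] /=.
  by rewrite big_nil big1 // => x _; rewrite expr0.
rewrite big_cons IHs; under [RHS]eq_bigr do rewrite exprD.
rewrite big_split /=; congr (_ * _).
rewrite (bigD1 y) //= eqxx expr1 big1 ?mulr1 //.
by move=> x /negPf xy; rewrite eq_sym xy expr0.
Qed.

Lemma prod_sum_tuple (R : comPzSemiRingType) (T : finType) K (G : 'I_K -> T -> R) :
  \prod_t \sum_x G t x = \sum_(s : K.-tuple T) \prod_t G t (tnth s t).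
Proof.
rewrite bigA_distr_bigA (reindex (fun s : K.-tuple T => [ffun t => tnth s t])) /=.
  by apply: eq_bigr => s _; apply: eq_bigr => t _; rewrite ffunE.
exists (fun f : {ffun 'I_K -> T} => [tuple f t | t < K]) => u _.
  by apply: eq_from_tnth => t; rewrite tnth_mktuple ffunE.
by apply/ffunP => t; rewrite ffunE tnth_mktuple.
Qed.

Lemma count_unzip1 (S T : finType) (s : seq (S * T)) x :
  count_mem x (unzip1 s) = (\sum_y count_mem (x, y) s)%N.
Proof.
elim: s => [|[u v] s IHs] /=; first by rewrite big1.
rewrite big_split IHs /=; congr (_ + _)%N.
by rewrite (bigD1 v) //= xpair_eqE eqxx andbT big1 ?addn0 // => y /negPf vy;
   rewrite xpair_eqE [v == y]eq_sym vy andbF.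
Qed.

Lemma count_unzip2 (S T : finType) (s : seq (S * T)) y :
  count_mem y (unzip2 s) = (\sum_x count_mem (x, y) s)%N.
Proof.
elim: s => [|[u v] s IHs] /=; first by rewrite big1.
rewrite big_split IHs /=; congr (_ + _)%N.
by rewrite (bigD1 u) //= xpair_eqE eqxx big1 ?addn0 // => x /negPf ux;
   rewrite xpair_eqE [u == x]eq_sym ux.
Qed.

(** * Bounds on the permanent from positive vectors and from a single table *)

Section KroneckerBounds.
Variables (R : realType) (n m : nat) (A : 'M[R]_n).
Hypothesis A_ge0 : forall i j, 0 <= A i j.
Let b := block_tuple n m.

Lemma permanent_tens_ones_ub (x y : 'I_n -> R) :
  (forall i, 0 < x i) -> (forall i, 0 < y i) ->
  permanent (A *t ones_mx R m) * (\prod_i x i * \prod_j y j) ^+ m <=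
  m`!%:R ^+ n * ((\sum_i \sum_j x i * A i j * y j) / n%:R) ^+ (n * m).
Proof.
move=> x_gt0 y_gt0.
have rowE i : \sum_j x i * A i j * y j = x i * \sum_j A i j * y j.
  by rewrite mulr_sumr; apply: eq_bigr => j _; rewrite mulrA.
have row_ge0 i : 0 <= \sum_j A i j * y j.
  by apply: sumr_ge0 => j _; rewrite mulr_ge0 // ltW.
have colb : permanent (A *t ones_mx R m) * (\prod_j y j) ^+ m <=
    m`!%:R ^+ n * (\prod_i \sum_j A i j * y j) ^+ m.
  rewrite permanent_tens_onesE -mulrA ler_wpM2l ?exprn_ge0 ?ler0n //.
  have -> : (\prod_i \sum_j A i j * y j) ^+ m =
      \prod_t \sum_j A (tnth b t) j * y j.
    rewrite (prod_tuple_count (fun i => \sum_j A i j * y j)) -prodrXl.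
    by apply: eq_bigr => i _; rewrite count_block_tuple.
  rewrite (prod_sum_tuple (fun t j => A (tnth b t) j * y j)) mulr_suml.
  (* The expanded product runs over all colourings of the columns. Those with every colour used [m]
     times give the permanent, and the others are nonnegative. *)
  rewrite [leRHS](bigID (fun c : (n * m).-tuple 'I_n => perm_eq c b)) /=.
  rewrite ler_wpDr ?sumr_ge0 // => [c _|].
    by apply: prodr_ge0 => t _; rewrite mulr_ge0 // ltW.
  rewrite le_eqVlt; apply/orP; left; apply/eqP/eq_bigr => c /seq.permP cb.
  rewrite big_split /=; congr (_ * _).
  rewrite prod_tuple_count -prodrXl; apply: eq_bigr => j _.
  by rewrite cb count_block_tuple.
rewrite exprMn mulrCA (le_trans (ler_wpM2l _ colb)) //.
  by rewrite exprn_ge0 // prodr_ge0 // => i _; rewrite ltW.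
rewrite mulrCA ler_wpM2l ?exprn_ge0 ?ler0n // -exprMn -big_split /= exprM.
have E_ge0 i : 0 <= x i * \sum_j A i j * y j by rewrite mulr_ge0 // ltW.
rewrite lerXn2r ?nnegrE ?prodr_ge0 ?exprn_ge0 ?divr_ge0 ?sumr_ge0 //.
  by move=> i _; rewrite rowE.
under [X in _ <= (X / _) ^+ _]eq_bigr do rewrite rowE.
have /= := @leif_AGM _ _ predT (fun i => x i * \sum_j A i j * y j) (fun i _ => E_ge0 i).
by rewrite cardT size_enum_ord => /leifP; case: ifP => _ => [/eqP ->|/ltW].
Qed.

(** In the symmetrised sum, only the pairs of row and column colourings with joint counts [N] are
    kept. There are [K! / prod N_ij!] of them, with [K = n * m], and all contribute the same
    product. *)
Lemma permanent_tens_ones_lb (N : 'I_n -> 'I_n -> nat) :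
  (forall i, \sum_j N i j = m)%N -> (forall j, \sum_i N i j = m)%N ->
  m`!%:R ^+ n ^+ 2 * \prod_i \prod_j A i j ^+ N i j <=
  permanent (A *t ones_mx R m) * \prod_i \prod_j (N i j)`!%:R.
Proof.
move=> rowN colN.
set P := \prod_i \prod_j A i j ^+ N i j; set F := \prod_i \prod_j _.
pose Np (p : 'I_n * 'I_n) := N p.1 p.2.
have sumN : (\sum_p Np p = n * m)%N.
  rewrite -(pair_big predT predT N) /=.
  by rewrite (eq_bigr _ (fun i _ => rowN i)) sum_nat_const card_ord.
have FE : F = (\prod_p (Np p)`!)%:R.
  by rewrite natr_prod /F (pair_big predT predT (fun i j => (N i j)`!%:R)).
have F_gt0 : 0 < F by apply: prodr_gt0 => i _; apply: prodr_gt0 => j _; rewrite ltr0n fact_gt0.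
have K_gt0 : 0 < (n * m)`!%:R :> R by rewrite ltr0n fact_gt0.
have := card_tuple_counts sumN.
set D := [pred s | _] => /(congr1 (GRing.natmul (1 : R))); rewrite natrM -FE => DE.
rewrite -(ler_pM2l K_gt0) [leRHS]mulrA permanent_tens_ones_sym -DE.
set S := \sum_(r | _) _; set M := m`!%:R ^+ n; set d := #|D|%:R.
have -> : d * F * (M ^+ 2 * P) = M ^+ 2 * F * (P * d) by ring.
have -> : M * (M * S) * F = M ^+ 2 * F * S by ring.
rewrite ler_wpM2l ?mulr_ge0 ?exprn_ge0 ?ler0n ?(ltW F_gt0) // /S /d.
rewrite mulr_natr -sumr_const.
(* A pair of colourings is one colouring by pairs, to which the multinomial count applies. *)
pose U (h : (n * m).-tuple ('I_n * 'I_n)) := ([tuple of unzip1 h], [tuple of unzip2 h]).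
rewrite pair_big_dep /= (reindex U) /=; last first.
  exists (fun rc : (n * m).-tuple 'I_n * (n * m).-tuple 'I_n =>
    [tuple of zip rc.1 rc.2]) => [h _|[r c] _].
    by apply: val_inj; rewrite /= zip_unzip.
  by congr (_, _); apply: val_inj; rewrite /= ?unzip1_zip ?unzip2_zip ?size_tuple.
rewrite [leRHS](bigID (mem D)) /= ler_wpDr ?sumr_ge0 // => [h _|].
  by apply: prodr_ge0.
rewrite le_eqVlt; apply/orP; left; apply/eqP/esym/eq_big => h.
  rewrite !inE andb_idl // => /forallP hN.
  apply/andP; split; apply/allP => i _; rewrite /= count_block_tuple.
    by rewrite count_unzip1 -[X in _ == X](rowN i); apply/eqP/eq_bigr => j _; rewrite (eqP (hN _)).
  by rewrite count_unzip2 -[X in _ == X](colN i); apply/eqP/eq_bigr => j _; rewrite (eqP (hN _)).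
move=> /andP[_ /forallP hN].
rewrite /P (pair_big predT predT (fun i j => A i j ^+ N i j)) /=.
transitivity (\prod_t A (tnth h t).1 (tnth h t).2).
  by apply: eq_bigr => t _; rewrite !tnth_map.
rewrite (prod_tuple_count (fun p => A p.1 p.2)).
by apply: eq_bigr => p _; rewrite (eqP (hN p)).
Qed.

End KroneckerBounds.

(** * Optimal tables and potentials *)

Section Potentials.
Variables (R : realFieldType) (T : finType) (C : T -> T -> R).
Hypothesis C_gt0 : forall i j, 0 < C i j.

(** Multiplicative length of a walk: least products play the part of shortest distances, and weight
    below 1 that of a negative cycle. *)
Fixpoint walk_weight x p := if p is y :: p' then C x y * walk_weight y p' else 1.

Lemma walk_weight_gt0 x p : 0 < walk_weight x p.
Proof. by elim: p x => //= y p IHp x; rewrite mulr_gt0. Qed.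

Lemma walk_weight_cat x p q :
  walk_weight x (p ++ q) = walk_weight x p * walk_weight (last x p) q.
Proof. by elim: p x => [|y p IHp] x /=; rewrite ?mul1r // IHp mulrA. Qed.

Lemma prod_walk_weight f x q z : map f (x :: q) = rcons q z ->
  \prod_(i <- x :: q) C i (f i) = walk_weight x (rcons q z).
Proof.
elim: q x => [|y q IHq] x /=; first by case=> fx; rewrite big_seq1 fx mulr1.
by case=> fx fq; rewrite big_cons IHq //= fx.
Qed.

Lemma map_next (x : T) q : uniq (x :: q) -> map (next (x :: q)) (x :: q) = rcons q x.
Proof.
move=> Uq; apply: (@eq_from_nth _ x) => [|k]; rewrite size_map ?size_rcons // => kq.
by rewrite (nth_map x) // next_nth mem_nth // index_uniq // nth_rcons_default.
Qed.

(* Potentials are shortest distances along simple walks; the assumption says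
   that no cycle has weight less than 1. *)
Lemma potential_exists : (forall i, C i i = 1) ->
  (forall s : {perm T}, 1 <= \prod_i C i (s i)) ->
  exists2 x : T -> R, (forall i, 0 < x i) & (forall i j, x j <= x i * C i j).
Proof.
move=> C1 Cperm.
(* A simple cycle is a permutation fixing all other points, where [C] contributes 1. *)
have cycle_ge1 y q : uniq (y :: q) -> 1 <= walk_weight y (rcons q y).
  move=> Uq; rewrite -(prod_walk_weight (map_next Uq)) big_uniq //.
  have := Cperm (perm (can_inj (prev_next Uq))).
  rewrite (bigID (mem (y :: q))) /= [X in _ * X]big1 ?mulr1.
    by under eq_bigr do rewrite permE.
  by move=> i /negPf iq; rewrite permE next_nth iq C1.
(* Bounding the length makes the walks a finite type, so the minimum exists; simple walks fit the
   bound. The start is free and only the end [k] is prescribed. *)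
pose W (u : T * #|T|.-bseq T) := walk_weight u.1 u.2.
pose P k (u : T * #|T|.-bseq T) := uniq (u.1 :: u.2) && (last u.1 u.2 == k).
have P0 k : P k (k, [bseq]) by rewrite /P /= eqxx.
pose d k := W [arg min_(u < (k, [bseq]) | P k u) W u]%O.
have d_le k x p : uniq (x :: p) -> last x p = k -> d k <= walk_weight x p.
  move=> Up lp; have szp : (size p <= #|T|)%N.
    by rewrite ltnW //; have /= <- := card_uniqP Up; rewrite max_card.
  rewrite /d; case: arg_minP => // u _ /(_ (x, Bseq szp)).
  by apply; rewrite /P /= -lp eqxx andbT.
exists d => [i|i j]; first exact: walk_weight_gt0.
rewrite {2}/d; case: arg_minP => // -[x [p szp]]; rewrite /P /W /= => /andP[Up /eqP lp] _.
have {}Up : uniq (x :: p) := Up.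
(* If the optimal walk to [i] avoids [j], appending [j] keeps it simple. Otherwise it is cut at [j]:
   the discarded tail together with the arc from [i] to [j] is a cycle, of weight at least 1. *)
have [jp|jNp] := boolP (j \in x :: p); last first.
  have -> : walk_weight x p * C i j = walk_weight x (rcons p j).
    by rewrite -cats1 walk_weight_cat /= mulr1 lp.
  by apply: d_le; rewrite ?last_rcons // -rcons_cons rcons_uniq jNp.
case/splitPl: p / jp szp Up lp => p1 p2 jE _ Up lp.
have [U1 U2] : uniq (x :: p1) /\ uniq (j :: p2).
  move: Up; rewrite -cat_cons cat_uniq => /and3P[U1 disj U2]; split=> //=.
  rewrite U2 andbT; apply: contra disj => jp2; apply/hasP; exists j => //.
  by rewrite -jE mem_last.
rewrite walk_weight_cat jE -mulrA; apply: (le_trans (d_le _ _ _ U1 jE)).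
rewrite ler_peMr ?(ltW (walk_weight_gt0 _ _)) //.
have := cycle_ge1 _ _ U2; rewrite -cats1 walk_weight_cat /= mulr1.
by move: lp; rewrite last_cat jE => ->.
Qed.

End Potentials.

Section RowWeight.
Variables (R : realFieldType) (n : nat) (a : 'I_n -> R).
Hypothesis a_gt0 : forall j, 0 < a j.

Definition row_weight (u : 'I_n -> nat) : R := \prod_j (a j ^+ u j / (u j)`!%:R).

Lemma row_weight_gt0 u : 0 < row_weight u.
Proof. by apply: prodr_gt0 => j _; rewrite divr_gt0 ?exprn_gt0 ?ltr0n ?fact_gt0. Qed.

Lemma row_weight_incr u h :
  row_weight (fun j => u j + (h == j))%N = row_weight u * (a h / (u h).+1%:R).
Proof.
rewrite /row_weight (bigD1 h) //= [in RHS](bigD1 h) //= eqxx addn1 factS exprS.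
rewrite (eq_bigr (fun j => a j ^+ u j / (u j)`!%:R)); last first.
  by move=> j /negPf jh; rewrite eq_sym jh addn0.
rewrite natrM invfM.
set Q := \prod_(i | _) _; set F := _`!%:R^-1; set S := _.+1%:R^-1.
by ring.
Qed.

(** Equality holds when [g] and [h] differ. When they coincide the row is unchanged, while the left
    side carries the factor [u g / (u g + 1)]. *)
Lemma row_weight_move u g h : (0 < u g)%N ->
  row_weight u * ((u g)%:R / a g) * (a h / (u h).+1%:R) <=
  row_weight (fun j => u j - (g == j) + (h == j))%N.
Proof.
move=> ug; pose v j := (u j - (g == j))%N.
have -> : row_weight u * ((u g)%:R / a g) = row_weight v.
  have -> : row_weight u = row_weight (fun j => v j + (g == j))%N.
    apply: eq_bigr => j _; rewrite /v subnK //.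
    by case: eqP => // <-.
  rewrite row_weight_incr /v eqxx subn1 prednK //.
  by field; rewrite pnatr_eq0 -lt0n ug gt_eqF.
rewrite (row_weight_incr v) ler_wpM2l ?(ltW (row_weight_gt0 _)) //.
by rewrite ler_wpM2l ?(ltW (a_gt0 _)) // lef_pV2 ?posrE ?ltr0n // ler_nat ltnS leq_subr.
Qed.

End RowWeight.

(** * Tables of largest weight and their scalings *)

Section OptimalTransport.
Variables (R : realFieldType) (n m : nat) (A : 'I_n -> 'I_n -> R).
Hypothesis A_gt0 : forall i j, 0 < A i j.
Hypothesis m_gt0 : (0 < m)%N.

Definition margins (N : 'I_n -> 'I_n -> nat) :=
  (forall i, \sum_j N i j = m)%N /\ (forall j, \sum_i N i j = m)%N.

Definition table_weight (N : 'I_n -> 'I_n -> nat) := \prod_i row_weight (A i) (N i).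

Lemma optimal_table_exists : exists2 N, margins N &
  forall N', margins N' -> table_weight N' <= table_weight N.
Proof.
(* Margins [m] bound every entry by [m], so the maximum is over a finite type; the table with [m] on
   the diagonal starts the search. *)
pose tab (f : {ffun 'I_n * 'I_n -> 'I_m.+1}) i j : nat := f (i, j).
pose P f := [forall i, \sum_j tab f i j == m]%N && [forall j, \sum_i tab f i j == m]%N.
have PE f : reflect (margins (tab f)) (P f).
  by apply: (iffP andP) => -[r c]; split; [
    move=> i; apply/eqP/(forallP r)| move=> i; apply/eqP/(forallP c)|
    apply/forallP => i; apply/eqP/r| apply/forallP => i; apply/eqP/c].
pose f0 : {ffun 'I_n * 'I_n -> 'I_m.+1} := [ffun p => if p.1 == p.2 then ord_max else ord0].
have P0 : P f0.
  apply/PE; split=> i.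
    rewrite (bigD1 i) //= big1 ?addn0 => [|j /negPf ji]; rewrite /tab ffunE /= ?eqxx //.
    by rewrite eq_sym ji.
  by rewrite (bigD1 i) //= big1 ?addn0 => [|j /negPf ji]; rewrite /tab ffunE /= ?eqxx ?ji.
case: (@arg_maxP _ _ _ f0 P (fun f => table_weight (tab f)) P0) => f /PE Pf f_max.
exists (tab f) => // N' N'm.
have N'le i j : (N' i j < m.+1)%N by rewrite ltnS -(N'm.1 i) (bigD1 j) //= leq_addr.
pose f' : {ffun 'I_n * 'I_n -> 'I_m.+1} := [ffun p => inord (N' p.1 p.2)].
have f'E i j : tab f' i j = N' i j by rewrite /tab ffunE inordK.
have Pf' : P f'.
  by apply/PE; split=> i; under eq_bigr do rewrite f'E; [apply: N'm.1|apply: N'm.2].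
have := f_max f' Pf'; congr (_ <= _); apply: eq_bigr => i _; apply: eq_bigr => j _.
by rewrite f'E.
Qed.

(* Optimality against moving one unit along each arc of a cycle of rows is the
   absence of a cycle of weight less than 1, so that potentials exist. *)
Lemma optimal_table_scaling N : margins N ->
  (forall N', margins N' -> table_weight N' <= table_weight N) ->
  exists x y : 'I_n -> R, [/\ forall i, 0 < x i, forall j, 0 < y j &
    forall i j, (N i j)%:R <= x i * A i j * y j <= (N i j)%:R + 1].
Proof.
move=> [rowN colN] N_max.
(* Moving a unit of column [j] from row [i] to a different row [i'] divides the table weight by this
   ratio. Below, [f i i'] is the column with the least ratio among those where row [i] has a
   unit. *)
pose ratio i i' j := (N i' j).+1%:R * A i j / ((N i j)%:R * A i' j).
have f_ex i i' : exists j, (0 < N i j)%N &&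
    [forall k, (0 < N i k)%N ==> (ratio i i' j <= ratio i i' k)].
  have [j0 Nj0] : exists j, (0 < N i j)%N.
    apply/existsP; apply: contraTT m_gt0 => /existsPn N0.
    by rewrite -(rowN i) big1 // => j _; apply/eqP; have := N0 j; rewrite lt0n negbK.
  case: (@arg_minP _ _ _ j0 (fun j => 0 < N i j)%N (ratio i i') Nj0) => j Nj j_min.
  by exists j; rewrite Nj; apply/forallP => k; apply/implyP/j_min.
pose f i i' := xchoose (f_ex i i').
have f_gt0 i i' : (0 < N i (f i i'))%N by case/andP: (xchooseP (f_ex i i')).
have f_min i i' k : (0 < N i k)%N -> ratio i i' (f i i') <= ratio i i' k.
  by case/andP: (xchooseP (f_ex i i')) => _ /forallP/(_ k)/implyP.
pose C i i' := if i' == i then 1 else ratio i i' (f i i').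
have ratio_gt0 i i' j : (0 < N i j)%N -> 0 < ratio i i' j.
  by move=> Nj; rewrite divr_gt0 ?mulr_gt0 ?ltr0n.
have C_gt0 i i' : 0 < C i i' by rewrite /C; case: ifP => // _; apply: ratio_gt0.
have C1 i : C i i = 1 by rewrite /C eqxx.
(* Row [i] gives a unit in column [g i] to row [s i], and so receives one in column [g' i]. All
   margins survive, hence the weight cannot increase. *)
have C_perm (s : 'S_n) : 1 <= \prod_i C i (s i).
  pose g i := f i (s i).
  pose g' i := g (s^-1%g i).
  pose N' i j := (N i j - (g i == j) + (g' i == j))%N.
  have N'D i j : (N' i j + (g i == j) = N i j + (g' i == j))%N.
    by rewrite /N' addnAC subnK //; case: eqP => // <-; apply: f_gt0.
  have sum_eq (h : 'I_n) : (\sum_j (h == j) = 1)%N.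
    by rewrite (bigD1 h) //= eqxx big1 // => j /negPf; rewrite eq_sym => ->.
  have N'm : margins N'.
    split=> i; apply/eqP.
      rewrite -(rowN i) -(eqn_add2r (\sum_j (g i == j))) -big_split /=.
      by under eq_bigr do rewrite N'D; rewrite big_split /= !sum_eq.
    rewrite -(colN i) -(eqn_add2r (\sum_j (g j == i))) -big_split /=.
    under eq_bigr do rewrite N'D; rewrite big_split /= eqn_add2l.
    by rewrite (reindex_inj (@perm_inj _ s)) /=; under eq_bigr do rewrite /g' permK.
  (* [D] accounts for the unit lost and [E] for the unit gained. A row fixed by [s] does not change,
     so both are 1 there, in agreement with [C i i = 1]. *)
  pose D i := if s i == i then 1 else (N i (g i))%:R / A i (g i).
  pose E i := if s i == i then 1 else A i (g' i) / (N i (g' i)).+1%:R.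
  have rowW i : row_weight (A i) (N i) * (D i * E i) <= row_weight (A i) (N' i).
    rewrite /D /E; case: eqP => [si|_]; last first.
      by rewrite mulrA; apply: row_weight_move => //; apply: f_gt0.
    rewrite !mulr1 le_eqVlt; apply/orP; left; apply/eqP; apply: eq_bigr => j _.
    suff -> : N' i j = N i j by [].
    by rewrite /N' /g' -[in s^-1%g i]si permK subnK //; case: eqP => // <-; apply: f_gt0.
  have DE : \prod_i (D i * E i) = (\prod_i C i (s i))^-1.
    rewrite big_split /= [X in _ * X](reindex_inj (@perm_inj _ s)) -big_split /= -prodfV.
    apply: eq_bigr => i _; rewrite /D /E /C (inj_eq perm_inj).
    case: eqP => _; first by rewrite mulr1 invr1.
    rewrite /g' permK /ratio -/(g i); field.
    by rewrite nat1r !gt_eqF ?A_gt0 ?ltr0n ?f_gt0.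
  have W_gt0 : 0 < table_weight N by apply: prodr_gt0 => i _; apply: row_weight_gt0.
  have P_gt0 : 0 < \prod_i C i (s i) by apply: prodr_gt0.
  rewrite -invf_le1 // -DE -(ler_pM2l W_gt0) mulr1.
  apply: le_trans (N_max _ N'm); rewrite /table_weight -big_split /=; apply: ler_prod => i _.
  rewrite rowW andbT mulr_ge0 ?(ltW (row_weight_gt0 _ _)) //.
  by rewrite /D /E; case: ifP => _; rewrite ?mulr1 // mulr_ge0 // divr_ge0 ?ler0n // ltW.
have [x x_gt0 xC] := potential_exists C_gt0 C1 C_perm.
(* In column [j], [y j] must lie between [N i j / (x i * A i j)] and [(N i j + 1) / (x i * A i j)]
   for every [i]. This says that each lower end is below each upper end, so the largest lower end,
   attained at row [k j], can serve as [y j]. *)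
have xN i i' j : x i' * A i' j * (N i j)%:R <= (N i' j).+1%:R * (x i * A i j).
  have xA_gt0 k : 0 < x k * A k j by rewrite mulr_gt0.
  have [->|Nij] := posnP (N i j).
    by rewrite mulr0 mulr_ge0 ?ler0n ?ltW.
  have [->|i'i] := eqVneq i' i.
    by rewrite mulrC ler_wpM2r ?ltW // ltr_nat.
  have : x i' <= x i * ratio i i' j.
    by rewrite (le_trans (xC i i')) // ler_wpM2l ?(ltW (x_gt0 _)) // /C (negPf i'i) f_min.
  by rewrite /ratio !mulrA ler_pdivlMr ?mulr_gt0 ?ltr0n //; congr (_ <= _); ring.
have k_ex j : exists k, [forall i, (N i j)%:R / (x i * A i j) <= (N k j)%:R / (x k * A k j)].
  have i0 : 'I_n by exact: j.
  case: (@arg_maxP _ _ _ i0 predT (fun i => (N i j)%:R / (x i * A i j)) isT) => k _ k_max.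
  by exists k; apply/forallP => i; apply: k_max.
pose k j := xchoose (k_ex j).
pose y j := (N (k j) j)%:R / (x (k j) * A (k j) j).
have y_ge i j : (N i j)%:R / (x i * A i j) <= y j.
  exact: (forallP (xchooseP (k_ex j))).
exists x, y; split=> // [j|i j].
  have [i Ni] : exists i, (0 < N i j)%N.
    apply/existsP; apply: contraTT m_gt0 => /existsPn N0.
    by rewrite -(colN j) big1 // => i _; apply/eqP; have := N0 i; rewrite lt0n negbK.
  by apply: lt_le_trans (y_ge i j); rewrite divr_gt0 ?mulr_gt0 ?ltr0n.
rewrite mulrC -ler_pdivrMr ?mulr_gt0 // y_ge /= mulrC /y mulrA.
by rewrite ler_pdivrMr ?mulr_gt0 // natr1 xN.
Qed.

End OptimalTransport.

(** * Comparison with the scaling mean *)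

Section FactorialBounds.
Variable R : realType.

(** [k^k / k!] is one term of the exponential series at [k]. *)
Lemma exprn_le_fact k : k%:R ^+ k <= k`!%:R * expR k%:R :> R.
Proof.
case: k => [|k]; first by rewrite expr0 fact0 mul1r expR0.
rewrite mulrC -ler_pdivrMr ?ltr0n ?fact_gt0 //.
by apply: le_trans (expR_ge1Dxn k (ler0n _ _)); rewrite lerDr.
Qed.

(** The inequality [1 - t <= exp(-t)] at [t = 1 / (k + 1)], raised to the power [k + 1]. *)
Lemma expR1_exprn_le k : expR 1 * k%:R ^+ k.+1 <= k.+1%:R ^+ k.+1 :> R.
Proof.
have k1 : (k.+1%:R != 0 :> R) by rewrite pnatr_eq0.
have -> : expR 1 = (expR (k.+1%:R^-1) : R) ^+ k.+1 by rewrite -expRM_natl divff.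
rewrite -exprMn lerXn2r ?nnegrE ?mulr_ge0 ?expR_ge0 //.
have -> : k%:R = k.+1%:R * (1 - k.+1%:R^-1) :> R by rewrite mulrBr divff // mulr1 -natr1 addrK.
rewrite mulrCA ger_pMr ?ltr0n // -[leRHS](divff (lt0r_neq0 (expR_gt0 (k.+1%:R^-1 : R)))).
by rewrite ler_pM2l ?expR_gt0 // -expRN expR_ge1Dx.
Qed.

Lemma fact_le_exprn k : k`!%:R * expR k%:R <= expR 1 * k.+1%:R * k%:R ^+ k :> R.
Proof.
case: k => [|k]; first by rewrite expr0 fact0 mul1r expR0 !mulr1 (le_trans _ (expR_ge1Dx _)) // lerDl.
(* The induction proves the sharper [k! e^k <= e k^(k+1)] for positive [k]; it fails at 0, which is
   treated apart. *)
apply: (@le_trans _ _ (expR 1 * k.+1%:R ^+ k.+2)); last first.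
  by rewrite exprS mulrA ler_wpM2r ?exprn_ge0 // ler_wpM2l ?expR_ge0 // ler_nat.
elim: k => [|k IHk]; first by rewrite expr1n mul1r mulr1.
rewrite -[in expR _]natr1 expRD factS natrM.
have -> : k.+2%:R * k.+1`!%:R * (expR k.+1%:R * expR 1) =
   expR 1 * k.+2%:R * (k.+1`!%:R * expR k.+1%:R) :> R by ring.
apply: le_trans (ler_wpM2l _ IHk) _; first by rewrite mulr_ge0 ?expR_ge0.
rewrite [k.+2%:R ^+ _]exprS -!mulrA ler_wpM2l ?expR_ge0 // ler_wpM2l //.
exact: expR1_exprn_le.
Qed.

End FactorialBounds.

Section ScalingMean.
Variables (R : realType) (n : nat).
Hypothesis n_gt0 : (0 < n)%N.

Lemma geom_meanX (x : 'cV[R]_n) : (forall i, 0 < x i ord0) ->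
  geom_mean x ^+ n = \prod_i x i ord0.
Proof.
move=> x_gt0; have p_ge0 : 0 <= \prod_i x i ord0 by apply: prodr_ge0 => i _; apply/ltW.
by rewrite -powR_mulrn ?powR_ge0 // -powRrM mulVf ?powRr1 // pnatr_eq0 -lt0n.
Qed.

Lemma geom_mean_gt0 (x : 'cV[R]_n) : (forall i, 0 < x i ord0) -> 0 < geom_mean x.
Proof. by move=> x_gt0; apply/powR_gt0/prodr_gt0. Qed.

Lemma bilinear_formE (A : 'M[R]_n) (x y : 'cV[R]_n) :
  (x^T *m A *m y) ord0 ord0 = \sum_i \sum_j x i ord0 * A i j * y j ord0.
Proof.
rewrite !mxE exchange_big /=; apply: eq_bigr => j _.
by rewrite !mxE mulr_suml; apply: eq_bigr => i _; rewrite !mxE.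
Qed.

Lemma scaling_mean_le (A : 'M[R]_n) (x y : 'cV[R]_n) :
  (forall i j, 0 <= A i j) -> (forall i, 0 < x i ord0) -> (forall i, 0 < y i ord0) ->
  scaling_mean A <= (n%:R ^+ 2)^-1 *
    ((\sum_i \sum_j x i ord0 * A i j * y j ord0) / (geom_mean x * geom_mean y)).
Proof.
move=> A_ge0 x_gt0 y_gt0; rewrite ler_wpM2l ?invr_ge0 ?exprn_ge0 //.
apply: ge_inf; last by exists x, y; rewrite bilinear_formE.
exists 0 => _ [u [v [u_gt0 v_gt0 ->]]]; rewrite bilinear_formE.
rewrite divr_ge0 //; last by rewrite ltW // mulr_gt0 ?geom_mean_gt0.
by rewrite sumr_ge0 // => i _; rewrite sumr_ge0 // => j _; rewrite !mulr_ge0 // ltW.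
Qed.

Lemma le_scaling_mean (A : 'M[R]_n) c :
  (forall x y : 'cV[R]_n, (forall i, 0 < x i ord0) -> (forall i, 0 < y i ord0) ->
    c <= (n%:R ^+ 2)^-1 *
      ((\sum_i \sum_j x i ord0 * A i j * y j ord0) / (geom_mean x * geom_mean y))) ->
  c <= scaling_mean A.
Proof.
move=> c_le; rewrite -ler_pdivrMl ?invr_gt0 ?exprn_gt0 ?ltr0n // invrK.
apply: lb_le_inf.
  have one_gt0 i : 0 < (const_mx 1 : 'cV[R]_n) i ord0 by rewrite mxE.
  by eexists; exists (const_mx 1), (const_mx 1).
move=> _ [x [y [x_gt0 y_gt0 ->]]]; rewrite bilinear_formE.
by rewrite -ler_pdivlMl ?exprn_gt0 ?ltr0n // c_le.
Qed.

Lemma scaling_mean_ge0 (A : 'M[R]_n) : (forall i j, 0 <= A i j) -> 0 <= scaling_mean A.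
Proof.
move=> A_ge0; apply: le_scaling_mean => x y x_gt0 y_gt0.
rewrite mulr_ge0 ?invr_ge0 ?exprn_ge0 // divr_ge0 //; last first.
  by rewrite ltW // mulr_gt0 ?geom_mean_gt0.
by rewrite sumr_ge0 // => i _; rewrite sumr_ge0 // => j _; rewrite !mulr_ge0 // ltW.
Qed.

End ScalingMean.

(** * Bounds on the normalised permanent by bilinear forms *)

Section PermanentalBounds.
Variables (R : realType) (n m : nat).
Hypotheses (n_gt0 : (0 < n)%N) (m_gt0 : (0 < m)%N).
(** Dominates the error [e (k + 1)] of [fact_le_exprn] for all [k] up to [n * m], so each factorial
    bounded above costs one factor [Q]. *)
Let Q : R := expR 1 * (n * m).+1%:R.

Let Q_ge1 : 1 <= Q.
Proof.
rewrite -[1]mulr1 ler_pM ?ler1n //.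
by rewrite (le_trans _ (expR_ge1Dx _)) // lerDl.
Qed.

Lemma permanent_tens_ones_ub_scaling (A : 'M[R]_n) (x y : 'cV[R]_n) :
  (forall i j, 0 <= A i j) -> (forall i, 0 < x i ord0) -> (forall i, 0 < y i ord0) ->
  permanent (A *t ones_mx R m) / (n * m)`!%:R <=
  Q ^+ (n ^ 2).+1 * ((n%:R ^+ 2)^-1 *
    ((\sum_i \sum_j x i ord0 * A i j * y j ord0) / (geom_mean x * geom_mean y))) ^+ (n * m).
Proof.
move=> A_ge0 x_gt0 y_gt0.
have := @permanent_tens_ones_ub R n m A A_ge0 (x^~ ord0) (y^~ ord0) x_gt0 y_gt0.
set q := \sum_i _; set p := permanent _ => p_le.
have q_ge0 : 0 <= q.
  by rewrite sumr_ge0 // => i _; rewrite sumr_ge0 // => j _; rewrite !mulr_ge0 // ltW.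
have n0 : n%:R != 0 :> R by rewrite pnatr_eq0 -lt0n.
have g_gt0 : 0 < geom_mean x * geom_mean y by rewrite mulr_gt0 ?geom_mean_gt0.
have gX : (geom_mean x * geom_mean y) ^+ (n * m) =
    ((\prod_i x i ord0) * (\prod_i y i ord0)) ^+ m.
  by rewrite exprM exprMn !geom_meanX.
have fact_le : m`!%:R ^+ n * n%:R ^+ (n * m) <= Q ^+ (n ^ 2).+1 * (n * m)`!%:R.
  have e_gt0 : 0 < expR (n * m)%:R :> R by rewrite expR_gt0.
  rewrite -(ler_pM2r e_gt0).
  have -> : m`!%:R ^+ n * n%:R ^+ (n * m) * expR (n * m)%:R =
      n%:R ^+ (n * m) * (m`!%:R * expR m%:R) ^+ n :> R.
    by rewrite exprMn -expRM_natl natrM; ring.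
  apply: (@le_trans _ _ (n%:R ^+ (n * m) * (Q * m%:R ^+ m) ^+ n)).
    rewrite ler_wpM2l ?exprn_ge0 // lerXn2r ?nnegrE ?mulr_ge0 ?expR_ge0 ?exprn_ge0 //.
    apply: (le_trans (fact_le_exprn _ _)); rewrite ler_wpM2r ?exprn_ge0 //.
    by rewrite ler_wpM2l ?expR_ge0 // ler_nat ltnS leq_pmull.
  rewrite exprMn mulrCA -exprM [(m * n)%N]mulnC -exprMn -mulrA ler_pM ?exprn_ge0 //.
  - by rewrite (le_trans _ Q_ge1).
  (* Only [n] factors [Q] arise here; the exponent is raised to the one of the lower bound. *)
  - by rewrite ler_weXn2l // ltnW // ltnS expnS expn1 leq_pmulr.
  - by rewrite -natrM; apply: exprn_le_fact.
rewrite ler_pdivrMr ?ltr0n ?fact_gt0 //.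
have -> : Q ^+ (n ^ 2).+1 *
    ((n%:R ^+ 2)^-1 * (q / (geom_mean x * geom_mean y))) ^+ (n * m) * (n * m)`!%:R =
    Q ^+ (n ^ 2).+1 * (n * m)`!%:R * ((n%:R ^+ 2)^-1 * q) ^+ (n * m) /
    (geom_mean x * geom_mean y) ^+ (n * m).
  by rewrite mulrA [(_ / (_ * _)) ^+ _]exprMn exprVn; ring.
rewrite ler_pdivlMr ?exprn_gt0 // gX; apply: (le_trans p_le).
have -> : m`!%:R ^+ n * (q / n%:R) ^+ (n * m) =
    m`!%:R ^+ n * n%:R ^+ (n * m) * ((n%:R ^+ 2)^-1 * q) ^+ (n * m).
  by rewrite -mulrA -exprMn; congr (_ * _ ^+ _); field.
by rewrite ler_wpM2r // exprn_ge0 // mulr_ge0 // invr_ge0 exprn_ge0.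
Qed.

(** Any lower bound [s] of the normalised forms is allowed, so that the scaling mean of a smaller
    matrix can be used. The exponent counts the [n ^ 2] factorials of the table entries and the
    factorial of [n * m]. *)
Lemma permanent_tens_ones_lb_scaling (A : 'M[R]_n) (s : R) :
  (forall i j, 0 < A i j) -> 0 <= s ->
  (forall x y : 'cV[R]_n, (forall i, 0 < x i ord0) -> (forall i, 0 < y i ord0) ->
    s <= (n%:R ^+ 2)^-1 *
      ((\sum_i \sum_j x i ord0 * A i j * y j ord0) / (geom_mean x * geom_mean y))) ->
  (s * (m%:R / (m + n)%:R)) ^+ (n * m) <=
  Q ^+ (n ^ 2).+1 * (permanent (A *t ones_mx R m) / (n * m)`!%:R).
Proof.
move=> A_gt0 s_ge0 s_le.
have [N N_marg N_max] := optimal_table_exists m A.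
have [x [y [x_gt0 y_gt0 xyN]]] := optimal_table_scaling A_gt0 m_gt0 N_marg N_max.
have [rowN colN] := N_marg.
have := @permanent_tens_ones_lb R n m A (fun i j => ltW (A_gt0 i j)) N rowN colN.
set p := permanent _ => p_ge.
pose G := (\prod_i x i * \prod_i y i) ^+ m.
have G_gt0 : 0 < G by rewrite exprn_gt0 // mulr_gt0 ?prodr_gt0.
have sumN : (\sum_i \sum_j N i j = n * m)%N.
  by rewrite (eq_bigr _ (fun i _ => rowN i)) sum_nat_const card_ord.
(* The lower half of the scaling inequality, raised to the powers [N i j]; the margins collect the
   [x i] and [y j] into [G]. *)
have NA : \prod_i \prod_j (N i j)%:R ^+ N i j <= G * \prod_i \prod_j A i j ^+ N i j.
  have -> : G * \prod_i \prod_j A i j ^+ N i j =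
      \prod_i \prod_j (x i * A i j * y j) ^+ N i j.
    have -> : G = \prod_i \prod_j (x i ^+ N i j * y j ^+ N i j).
      under [RHS]eq_bigr do rewrite big_split /=.
      rewrite big_split /= [X in _ = _ * X]exchange_big /= /G exprMn -!prodrXl.
      by congr (_ * _); apply: eq_bigr => i _; rewrite prodrXr ?rowN ?colN.
    rewrite -big_split; apply: eq_bigr => i _; rewrite -big_split.
    by apply: eq_bigr => j _; rewrite !exprMn /=; ring.
  apply: ler_prod => i _; rewrite prodr_ge0 ?exprn_ge0 //=.
  apply: ler_prod => j _; rewrite exprn_ge0 //= lerXn2r ?nnegrE //.
    by rewrite !mulr_ge0 // ltW.
  by case/andP: (xyN i j).
have N_ge : (\prod_i \prod_j (N i j)`!%:R) * expR (n * m)%:R <=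
    Q ^+ (n ^ 2) * \prod_i \prod_j (N i j)%:R ^+ N i j.
  have -> : expR (n * m)%:R = \prod_i \prod_j expR (N i j)%:R :> R.
    by rewrite -sumN natr_sum expR_sum; apply: eq_bigr => i _; rewrite natr_sum expR_sum.
  have -> : Q ^+ (n ^ 2) = \prod_(i < n) \prod_(j < n) Q.
    by rewrite !prodr_const !card_ord -exprM.
  rewrite -!big_split; apply: ler_prod => i _; rewrite -!big_split.
  have fe_ge0 j : 0 <= (N i j)`!%:R * expR (N i j)%:R :> R by rewrite mulr_ge0 ?expR_ge0.
  rewrite prodr_ge0 //=; apply: ler_prod => j _; rewrite fe_ge0 /=.
  apply: (le_trans (fact_le_exprn _ _)); rewrite ler_wpM2r ?exprn_ge0 //.
  rewrite ler_wpM2l ?expR_ge0 // ler_nat ltnS -sumN (bigD1 i) //= (bigD1 j) //=.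
  by rewrite -addnA leq_addr.
have mn_gt0 : 0 < (m + n)%:R :> R by rewrite ltr0n addn_gt0 m_gt0.
have n_neq0 : n%:R != 0 :> R by rewrite pnatr_eq0 -lt0n.
(* The upper half bounds the bilinear form by the sum of all [N i j + 1], which is [n (m + n)]. *)
have sG : s ^+ (n * m) * G <= ((m + n)%:R / n%:R) ^+ (n * m).
  pose xv : 'cV[R]_n := \col_i x i; pose yv : 'cV[R]_n := \col_i y i.
  have xv_gt0 i : 0 < xv i ord0 by rewrite mxE.
  have yv_gt0 i : 0 < yv i ord0 by rewrite mxE.
  have g_gt0 : 0 < geom_mean xv * geom_mean yv by rewrite mulr_gt0 ?geom_mean_gt0.
  have -> : G = (geom_mean xv * geom_mean yv) ^+ (n * m).
    rewrite exprM exprMn !geom_meanX // /G.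
    by congr ((_ * _) ^+ _); apply: eq_bigr => i _; rewrite mxE.
  rewrite -exprMn lerXn2r ?nnegrE ?divr_ge0 ?(mulr_ge0 s_ge0 (ltW g_gt0)) //.
  rewrite -ler_pdivlMr //; apply: (le_trans (s_le _ _ xv_gt0 yv_gt0)).
  rewrite mulrA ler_pM2r ?invr_gt0 // ler_pdivrMl ?exprn_gt0 ?ltr0n //.
  have -> : n%:R ^+ 2 * ((m + n)%:R / n%:R) = \sum_(i < n) \sum_(j < n) ((N i j)%:R + 1) :> R.
    under eq_bigr do rewrite big_split /= sumr_const card_ord -natr_sum rowN -natrD.
    by rewrite sumr_const card_ord -[RHS]mulr_natl; field.
  apply: ler_sum => i _; apply: ler_sum => j _; rewrite !mxE.
  by case/andP: (xyN i j).
set K := (n * m)%N in N_ge sG *; set M := m`!%:R ^+ n in p_ge.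
set a := \prod_i _ in p_ge NA; set F := \prod_i _ in p_ge N_ge.
set B := \prod_i _ in NA N_ge; set e := expR K%:R in N_ge.
have Q_gt0 : 0 < Q by rewrite (lt_le_trans _ Q_ge1).
have e_gt0 : 0 < e by rewrite expR_gt0.
have F_gt0 : 0 < F by do 2![apply: prodr_gt0 => ? _]; rewrite ltr0n fact_gt0.
have M_ge0 : 0 <= M by rewrite exprn_ge0.
have Gp_ge : M ^+ 2 * e <= Q ^+ (n ^ 2) * (G * p).
  rewrite -(ler_pM2r F_gt0).
  have -> : M ^+ 2 * e * F = M ^+ 2 * (F * e) by ring.
  apply: (le_trans (ler_wpM2l _ N_ge)); first by rewrite exprn_ge0.
  have -> : Q ^+ (n ^ 2) * (G * p) * F = Q ^+ (n ^ 2) * (G * (p * F)) by ring.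
  rewrite mulrCA ler_wpM2l ?exprn_ge0 ?(ltW Q_gt0) //.
  apply: (@le_trans _ _ (M ^+ 2 * (G * a))); first by rewrite ler_wpM2l ?exprn_ge0.
  by rewrite mulrCA ler_wpM2l ?(ltW G_gt0).
have KX : K%:R ^+ K = n%:R ^+ K * m%:R ^+ K :> R by rewrite -exprMn -natrM.
have mX : m%:R ^+ K <= M * e.
  have -> : M * e = (m`!%:R * expR m%:R) ^+ n.
    by rewrite exprMn -expRM_natl -natrM.
  rewrite /K mulnC exprM lerXn2r ?nnegrE ?mulr_ge0 ?expR_ge0 ?exprn_ge0 //.
  exact: exprn_le_fact.
(* The upper factorial bound for [K], with [K^K = n^K m^K], and the lower one for [m], used
   twice. *)
have factK : m%:R ^+ K * K`!%:R <= Q * n%:R ^+ K * (M ^+ 2 * e).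
  rewrite -(ler_pM2r e_gt0) -[leLHS]mulrA.
  apply: (le_trans (ler_wpM2l _ (fact_le_exprn _ _))); first by rewrite exprn_ge0.
  rewrite KX -/Q.
  have -> : m%:R ^+ K * (Q * (n%:R ^+ K * m%:R ^+ K)) =
    Q * n%:R ^+ K * (m%:R ^+ K) ^+ 2 by ring.
  have -> : Q * n%:R ^+ K * (M ^+ 2 * e) * e = Q * n%:R ^+ K * (M * e) ^+ 2 by ring.
  rewrite ler_wpM2l ?mulr_ge0 ?exprn_ge0 ?(ltW Q_gt0) //.
  by rewrite lerXn2r ?nnegrE ?mulr_ge0 ?exprn_ge0 ?(ltW e_gt0).
rewrite mulrA ler_pdivlMr ?ltr0n ?fact_gt0 // -(ler_pM2r G_gt0).
have nK_gt0 : 0 < (n%:R : R) ^+ K by rewrite exprn_gt0 ?ltr0n.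
rewrite -(ler_pM2r nK_gt0).
have -> : (s * (m%:R / (m + n)%:R)) ^+ K * K`!%:R * G * n%:R ^+ K =
    s ^+ K * G * (n%:R ^+ K / (m + n)%:R ^+ K * (m%:R ^+ K * K`!%:R)).
  by rewrite !exprMn exprVn; ring.
apply: (@le_trans _ _ (m%:R ^+ K * K`!%:R)).
  rewrite [leLHS]mulrA ger_pMl ?mulr_gt0 ?exprn_gt0 ?ltr0n ?fact_gt0 //.
  rewrite -ler_pdivlMr ?(divr_gt0 nK_gt0) ?(exprn_gt0 _ mn_gt0) // mul1r invf_div.
  by apply: (le_trans sG); rewrite exprMn exprVn.
apply: (le_trans factK).
have -> : Q ^+ (n ^ 2).+1 * p * G * n%:R ^+ K =
  Q * n%:R ^+ K * (Q ^+ (n ^ 2) * (G * p)) by rewrite exprS; ring.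
by rewrite ler_wpM2l ?mulr_ge0 ?exprn_ge0 ?(ltW Q_gt0).
Qed.

End PermanentalBounds.

(** * Vanishing errors and passage to the limit *)

(** A sequence tending to 1 whose power [n * k.+1] absorbs the accumulated factors [Q] for
    [m = k.+1]. *)
Definition error_factor (R : realType) n k : R :=
  expR (Num.sqrt (4 * expR 1 * harmonic k)) ^+ (n ^ 2).+1.

Lemma error_factor_gt0 (R : realType) n k : 0 < error_factor R n k.
Proof. by rewrite exprn_gt0 ?expR_gt0. Qed.

Lemma cvg_error_factor (R : realType) n : error_factor R n k @[k --> \oo] --> (1 : R).
Proof.
have c0 : 4 * expR 1 * harmonic k @[k --> \oo] --> (0 : R).
  rewrite -[X in _ --> X](mulr0 (4 * expR 1)).
  by apply: cvgM; [exact: cvg_cst|exact: cvg_harmonic].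
have c1 : Num.sqrt (4 * expR 1 * harmonic k) @[k --> \oo] --> (0 : R).
  by rewrite -[X in _ --> X](sqrtr0 R); exact: (continuous_cvg _ (@sqrt_continuous R 0) c0).
have c2 : expR (Num.sqrt (4 * expR 1 * harmonic k)) @[k --> \oo] --> (1 : R).
  by rewrite -[X in _ --> X]expR0; exact: (continuous_cvg _ (@continuous_expR R 0) c1).
rewrite -[X in _ --> X](expr1n R (n ^ 2).+1).
exact: (continuous_cvg _ (@exprn_continuous R (n ^ 2).+1 1) c2).
Qed.

Lemma permanent_ge0 (R : realType) n (B : 'M[R]_n) :
  (forall i j, 0 <= B i j) -> 0 <= permanent B.
Proof. by move=> B_ge0; apply: sumr_ge0 => s _; apply: prodr_ge0. Qed.

Section Limit.
Variables (R : realType) (n : nat).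
Hypothesis n_gt0 : (0 < n)%N.
Variable A : 'M[R]_n.
Hypothesis A_ge0 : forall i j, 0 <= A i j.

(* The bound for positive matrices does not depend on the entries except
   through [scaling_mean], which can only grow with them, so it survives the
   passage to the limit from [A + e] to [A]. *)
Lemma permanent_tens_ones_lb_limit m : (0 < m)%N ->
  (scaling_mean A * (m%:R / (m + n)%:R)) ^+ (n * m) <=
  (expR 1 * (n * m).+1%:R) ^+ (n ^ 2).+1 *
    (permanent (A *t ones_mx R m) / (n * m)`!%:R).
Proof.
move=> m_gt0.
have Q_gt0 : 0 < (expR 1 * (n * m).+1%:R) ^+ (n ^ 2).+1 :> R.
  by rewrite exprn_gt0 // mulr_gt0 ?expR_gt0.
have f_gt0 : 0 < (n * m)`!%:R :> R by rewrite ltr0n fact_gt0.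
rewrite mulrA ler_pdivlMr // -ler_pdivrMl //.
pose Ae e : 'M[R]_n := \matrix_(i, j) (A i j + e).
(* The permanent for [A + e] is a polynomial in [e], hence continuous at 0. *)
pose p : {poly R} := \sum_(s : 'S_(n * m)) \prod_(t < n * m)
  (((A *t ones_mx R m) t (s t))%:P + 'X).
have pE e : permanent (Ae e *t ones_mx R m) = p.[e].
  rewrite horner_sum; apply: eq_bigr => s _; rewrite horner_prod.
  by apply: eq_bigr => t _; rewrite !hornerE !mxE !mulr1.
have -> : permanent (A *t ones_mx R m) = p.[0].
  rewrite -pE; congr (permanent (_ *t _)).
  by apply/matrixP => i j; rewrite mxE addr0.
have pc : p.[e] @[e --> (0 : R)^'+] --> p.[0].
  exact/cvg_at_right_filter/continuous_horner.
apply: (cvgr_to_ge pc); near=> e.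
have e_gt0 : 0 < e by near: e; exact: nbhs_right_gt.
rewrite ler_pdivrMl // -ler_pdivlMr // -mulrA -pE.
apply: permanent_tens_ones_lb_scaling => // [i j||x y x_gt0 y_gt0].
- by rewrite mxE ltr_wpDl.
- exact: scaling_mean_ge0.
apply: (le_trans (scaling_mean_le A_ge0 x_gt0 y_gt0)).
rewrite ler_wpM2l ?invr_ge0 ?exprn_ge0 // ler_wpM2r //.
  by rewrite invr_ge0 ltW // mulr_gt0 ?geom_mean_gt0.
apply: ler_sum => i _; apply: ler_sum => j _; rewrite !mxE.
by rewrite ler_wpM2r ?(ltW (y_gt0 _)) // ler_wpM2l ?(ltW (x_gt0 _)) // lerDl ltW.
Unshelve. all: by end_near. Qed.

Lemma error_le_exprn k :
  (expR 1 * (n * k.+1).+1%:R) ^+ (n ^ 2).+1 <= error_factor R n k ^+ (n * k.+1).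
Proof.
rewrite /error_factor exprAC.
rewrite lerXn2r ?nnegrE ?mulr_ge0 ?exprn_ge0 ?expR_ge0 // -expRM_natl.
set K := (n * k.+1)%N; set d := Num.sqrt _.
have d2 : d ^+ 2 = 4 * expR 1 / k.+1%:R by rewrite sqr_sqrtr ?mulr_ge0 ?expR_ge0 ?invr_ge0.
have Kk : k.+1%:R <= K%:R :> R by rewrite ler_nat leq_pmull.
have K_ge1 : 1 <= K%:R :> R by rewrite (le_trans _ Kk) // ler1n.
have e_gt0 := @expR_gt0 R 1.
have d_ge0 : 0 <= d by exact: sqrtr_ge0.
(* The quadratic term of the exponential suffices: it equals [2 e K (K / (k + 1))], at least
   [2 e K], and [e (K + 1) <= 2 e K] as [K >= 1]. *)
apply: (@le_trans _ _ (1 + (K%:R * d) ^+ 2 / 2`!%:R)); last first.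
  by apply: expR_ge1Dxn; rewrite mulr_ge0.
rewrite exprMn d2 -natr1 (_ : 2`!%:R = 2) //.
have -> : K%:R ^+ 2 * (4 * expR 1 / k.+1%:R) / 2 = 2 * expR 1 * K%:R * (K%:R / k.+1%:R) :> R.
  by field.
have K1 : 1 <= K%:R / k.+1%:R :> R by rewrite ler_pdivlMr ?ltr0n // mul1r.
have : 2 * expR 1 * K%:R * 1 <= 2 * expR 1 * K%:R * (K%:R / k.+1%:R) :> R.
  by rewrite ler_wpM2l // !mulr_ge0 ?ltW.
have : expR 1 * 1 <= expR 1 * K%:R :> R by rewrite ler_wpM2l // ltW.
set X := _ * (K%:R / k.+1%:R); rewrite -!mulrA mulrDr !mulr1; set Y := expR 1 * K%:R.
lra.
Qed.

Lemma perm_mean_tens_ones_bounds k :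
  scaling_mean A * (1 + n%:R * harmonic k)^-1 / error_factor R n k <=
  perm_mean (A *t ones_mx R k.+1) <= error_factor R n k * scaling_mean A.
Proof.
set K := (n * k.+1)%N.
have K_gt0 : (0 < K)%N by rewrite muln_gt0 n_gt0.
set pm := perm_mean _; set P := permanent (A *t ones_mx R k.+1) / K`!%:R.
have P_ge0 : 0 <= P.
  rewrite divr_ge0 // permanent_ge0 // => i j; rewrite !mxE mulr1; exact: A_ge0.
have pm_ge0 : 0 <= pm by exact: powR_ge0.
have pmX : pm ^+ K = P.
  by rewrite -powR_mulrn // -powRrM mulVf ?powRr1 // pnatr_eq0 -lt0n.
apply/andP; split.
  rewrite ler_pdivrMr ?error_factor_gt0 //.
  have -> : (1 + n%:R * harmonic k)^-1 = k.+1%:R / (k.+1 + n)%:R :> R.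
    rewrite natrD /harmonic /=; field.
    by rewrite nat1r -natrD !pnatr_eq0.
  rewrite -(@ler_pXn2r _ K) ?nnegrE //.
  - rewrite [leRHS]exprMn pmX [leRHS]mulrC.
    apply: (le_trans (permanent_tens_ones_lb_limit (ltn0Sn k))).
    by rewrite ler_wpM2r // error_le_exprn.
  - by apply: mulr_ge0; [exact: scaling_mean_ge0|exact: divr_ge0].
  - by rewrite mulr_ge0 // ltW ?error_factor_gt0.
(* It suffices that the permanental mean over the error factor bounds every normalised form from
   below; this is checked on [K]-th powers. *)
rewrite -ler_pdivrMl ?error_factor_gt0 //; apply: le_scaling_mean => // x y x_gt0 y_gt0.
rewrite ler_pdivrMl ?error_factor_gt0 //; set v := _^-1 * _.
have v_ge0 : 0 <= v.
  by apply: le_trans (scaling_mean_ge0 n_gt0 A_ge0) _; exact: scaling_mean_le.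
rewrite -(@ler_pXn2r _ K) ?nnegrE ?(mulr_ge0 (ltW (error_factor_gt0 _ _ k)) v_ge0) // exprMn pmX.
apply: (le_trans (permanent_tens_ones_ub_scaling _ n_gt0 A_ge0 x_gt0 y_gt0)).
by rewrite ler_wpM2r ?exprn_ge0 // error_le_exprn.
Qed.

End Limit.

Unset Implicit Arguments.

Theorem theorem2p19 (R : realType) (n : nat) (hn : (0 < n)%N) (A : 'M[R]_n)
  (hA : forall i j, 0 <= A i j) :
  (fun m : nat => perm_mean (A *t ones_mx R m)) @ \oo --> scaling_mean A.
Proof.
have lower : scaling_mean A * (1 + n%:R * harmonic k)^-1 / error_factor R n k
    @[k --> \oo] --> scaling_mean A * (1 + n%:R * 0)^-1 / (1 : R).
  apply: cvgM; last by apply: cvgV; [rewrite oner_eq0|exact: cvg_error_factor].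
  apply: cvgM; first exact: cvg_cst.
  apply: cvgV; first by rewrite mulr0 addr0 oner_eq0.
  apply: cvgD; first exact: cvg_cst.
  by apply: cvgM; [exact: cvg_cst|exact: cvg_harmonic].
rewrite mulr0 addr0 invr1 !mulr1 in lower.
have upper : error_factor R n k * scaling_mean A @[k --> \oo] --> 1 * scaling_mean A.
  by apply: cvgM; [exact: cvg_error_factor|exact: cvg_cst].
rewrite mul1r in upper.
(* The bounds are for positive [m], so the sequence is shifted past [m = 0]. *)
suff shifted : perm_mean (A *t ones_mx R k.+1) @[k --> \oo] --> scaling_mean A.
  by rewrite -cvg_shiftS; exact: shifted.
apply: (squeeze_cvgr _ lower upper).
by apply: nearW => k; exact: perm_mean_tens_ones_bounds.
Qed.
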